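(* $f(n,1)\in O(n^2)$, i.e. there are a constant $C>0$ and $n_0\in\mathbb{N}$ such that $f(n,1)\le C\,n^2$ for all integers $n\ge n_0$.
   Context: One-dimensional Hegselmann--Krause (HK) system with strategic agents: there is a set $N=\{1,\dots,n\}$ of non-strategic agents and a disjoint set $S$ of $m=|S|$ strategic agents; $A=N\cup S$. At each discrete time $t\in\mathbb{N}_{\ge 0}$ every agent $i\in A$ has an opinion $x_i(t)\in\mathbb{R}$. The starting opinions $x_i(0)$, $i\in N$, are given. The opinions $x_s(t)$ of the strategic agents $s\in S$ can be chosen freely (as any real numbers) at every time $t$. For $i\in N$, $$x_i(t+1)=\frac{1}{|\mathcal{N}_i(t)|}\sum_{j\in\mathcal{N}_i(t)}x_j(t),\qquad \mathcal{N}_i(t)=\{j\in A: |x_i(t)-x_j(t)|\le 1\}.$$ The system has converged at time $t$ if for all $i,j\in N$ either $x_i(t)=x_j(t)$ or $|x_i(t)-x_j(t)|>1$. The convergence time is the smallest $t\in\mathbb{N}_{\ge 0}$ such that the system has converged at time $t$. For given starting opinions of the non-strategic agents and given $m$, the optimal convergence time is the minimum of the convergence time over all choices of the opinions of the $m$ strategic agents at all times. $f(n,m)$ denotes the supremum of the optimal convergence time over all starting opinions of $n$ non-strategic agents, with $m$ strategic agents. *)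

(* Defs.v *)
From HB Require Import structures.
From mathcomp Require Import all_boot all_order all_algebra.
From mathcomp Require Import all_classical all_reals ereal.
Set Implicit Arguments.
Unset Strict Implicit.
Unset Printing Implicit Defensive.
Import Order.TTheory GRing.Theory Num.Theory.
Local Open Scope classical_set_scope.
Local Open Scope ring_scope.

Section HegselmannKrause.
Variables (R : realType) (n m : nat).

(* [inl i] is the i-th non-strategic agent, [inr s] the s-th strategic one. *)
Definition agent := ('I_n + 'I_m)%type.

Definition profile (x : 'I_n -> R) (y : 'I_m -> R) (a : agent) : R :=
  match a with inl i => x i | inr s => y s end.

Definition neighborhood (z : agent -> R) (i : 'I_n) : {set agent} :=
  [set a : agent | `|z (inl i) - z a| <= 1]%SET.

Definition hk_step (z : agent -> R) (i : 'I_n) : R :=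
  (\sum_(a in neighborhood z i) z a) / #|neighborhood z i|%:R.

(* [y t s] is the opinion that the strategic agent [s] chooses at time [t].
   The dynamics is deterministic, so fixing all choices in advance loses no
   generality. *)
Fixpoint opinion (x0 : 'I_n -> R) (y : nat -> 'I_m -> R) (t : nat) :
    'I_n -> R :=
  match t with
  | 0%N => x0
  | t'.+1 => hk_step (profile (opinion x0 y t') (y t'))
  end.

Definition converged_at (x0 : 'I_n -> R) (y : nat -> 'I_m -> R) (t : nat) :
    Prop :=
  forall i j : 'I_n, opinion x0 y t i = opinion x0 y t j \/
                     1 < `|opinion x0 y t i - opinion x0 y t j|.

(* The smallest time of convergence, and +oo if there is none. *)
Definition convergence_time (x0 : 'I_n -> R) (y : nat -> 'I_m -> R) : \bar R :=
  ereal_inf [set (t%:R)%:E | t in [set t : nat | converged_at x0 y t]].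

Definition optimal_convergence_time (x0 : 'I_n -> R) : \bar R :=
  ereal_inf [set convergence_time x0 y | y in [set: nat -> 'I_m -> R]].

Definition worst_case_time : \bar R :=
  ereal_sup [set optimal_convergence_time x0 | x0 in [set: 'I_n -> R]].

End HegselmannKrause.

(* Main.v *)
(* Sort the agents; the dynamics preserves their order. Call a gap between
   consecutive opinions wide if it exceeds 1, and let the potential be the sum
   of all gaps that are not wide; it is at most n - 1. If some cluster (maximal
   run without wide gaps), with leftmost opinion l, is longer than 1, then the
   strategic agent plays l + 1. This lies in a gap that is not wide, so no wide
   gap shrinks and the extreme opinions do not move outwards; but the agents
   at l see nothing to their left and move right by at least 1 / (n + 1), so
   the potential drops by that amount. This can happen at most
   (n - 1)(n + 1) times. Once every cluster has length at most 1, the strategic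
   agent moves out of sight and every cluster collapses in one step. *)
Require Import Defs.
From HB Require Import structures.
From mathcomp Require Import all_boot all_order all_algebra.
From mathcomp Require Import all_classical all_reals ereal.
From mathcomp Require Import lra zify.
Set Implicit Arguments.
Unset Strict Implicit.
Unset Printing Implicit Defensive.
Import Order.TTheory GRing.Theory Num.Theory.
Local Open Scope ring_scope.

(** * One averaging step: bounds, order preservation, pull and collapse *)

Lemma mem_neighborhood (R : realType) n m (z : agent n m -> R) i a :
  (a \in neighborhood z i) = (`|z (inl i) - z a| <= 1).
Proof. by rewrite inE. Qed.

Lemma neighborhood_refl (R : realType) n m (z : agent n m -> R) i :
  inl i \in neighborhood z i.
Proof. by rewrite mem_neighborhood subrr normr0. Qed.

Lemma card_neighborhood_gt0 (R : realType) n m (z : agent n m -> R) i :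
  0 < #|neighborhood z i|%:R :> R.
Proof. by rewrite ltr0n; apply/card_gt0P; exists (inl i); exact: neighborhood_refl. Qed.

Lemma hk_step_le (R : realType) n m (z : agent n m -> R) i c :
  (forall a, a \in neighborhood z i -> z a <= c) -> hk_step z i <= c.
Proof.
move=> zc; rewrite /hk_step ler_pdivrMr ?card_neighborhood_gt0//.
by rewrite mulr_natr -sumr_const; exact: ler_sum.
Qed.

Lemma hk_step_ge (R : realType) n m (z : agent n m -> R) i c :
  (forall a, a \in neighborhood z i -> c <= z a) -> c <= hk_step z i.
Proof.
move=> zc; rewrite /hk_step ler_pdivlMr ?card_neighborhood_gt0//.
by rewrite mulr_natr -sumr_const; exact: ler_sum.
Qed.

Lemma hk_step_lt (R : realType) n m (z : agent n m -> R) i c :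
  (forall a, a \in neighborhood z i -> z a < c) -> hk_step z i < c.
Proof.
move=> zc; rewrite /hk_step ltr_pdivrMr ?card_neighborhood_gt0//.
rewrite mulr_natr -sumr_const; apply: ltr_sum => //.
by apply/hasP; exists (inl i); [rewrite mem_index_enum|exact: neighborhood_refl].
Qed.

Lemma hk_step_homo (R : realType) n m (z : agent n m -> R) i j :
  z (inl i) <= z (inl j) -> hk_step z i <= hk_step z j.
Proof.
move=> zij; rewrite /hk_step ler_pdivrMr ?card_neighborhood_gt0//.
rewrite mulrAC ler_pdivlMr ?card_neighborhood_gt0//.
set A := neighborhood z i; set B := neighborhood z j.
pose p a : R := (a \in A)%:R; pose q a : R := (a \in B)%:R.
have sumE (C : {set agent n m}) (F : agent n m -> R) :
    \sum_(a in C) F a = \sum_a (a \in C)%:R * F a.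
  by rewrite big_mkcond; apply: eq_bigr => a _; case: (a \in C); rewrite ?mul1r ?mul0r.
have cardE (C : {set agent n m}) : #|C|%:R = \sum_a (a \in C)%:R :> R.
  by rewrite -sumr_const sumE; apply: eq_bigr => a _; rewrite mulr1.
rewrite !sumE !cardE -/p -/q !mulr_suml.
under eq_bigr do rewrite mulr_sumr.
under [leRHS]eq_bigr do rewrite mulr_sumr.
rewrite -subr_le0 -(pmulr_rle0 _ (ltr0n R 2)).
(* Antisymmetrising in [(a, b)] makes every single term nonpositive. *)
suff -> : 2 * (\sum_a \sum_b p a * z a * q b - \sum_a \sum_b q a * z a * p b) =
    \sum_a \sum_b (p a * q b - p b * q a) * (z a - z b).
  (* If [z b < z a] with [a] in [A] and [b] in [B], both lie between [z (inl j) - 1] and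
     [z (inl i) + 1], hence in both neighbourhoods: the swapped product is 1 as well. *)
  apply: sumr_le0 => a _; apply: sumr_le0 => b _.
  rewrite /p /q /A /B !mem_neighborhood !ler_norml.
  do 4 (case: andP => [[? ?]|/andP];
    [|rewrite negb_and -!ltNge => /orP[] ?]);
    rewrite /= ?(mulr1n, mulr0n, mulr0, mul0r, mulr1, subr0, sub0r, subrr, mul1r);
    lra.
have e1 : \sum_a \sum_b p a * z a * q b = \sum_a \sum_b p b * z b * q a.
  by rewrite exchange_big.
have e2 : \sum_a \sum_b q a * z a * p b = \sum_a \sum_b q b * z b * p a.
  by rewrite exchange_big.
rewrite mulr_natl mulr2n {1}e1 {2}e2 -!sumrB -big_split; apply: eq_bigr => a _.
rewrite -!sumrB -big_split; apply: eq_bigr => b _ /=.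
lra.
Qed.

Lemma hk_step_le_gap (R : realType) n m (z : agent n m -> R) i :
  (forall a, z a <= z (inl i) \/ z (inl i) + 1 < z a) ->
  hk_step z i <= z (inl i).
Proof.
move=> gap; apply: hk_step_le => a; rewrite mem_neighborhood ler_norml.
by case: (gap a) => // ? /andP[? ?]; lra.
Qed.

Lemma hk_step_ge_gap (R : realType) n m (z : agent n m -> R) i :
  (forall a, z (inl i) <= z a \/ z a + 1 < z (inl i)) ->
  z (inl i) <= hk_step z i.
Proof.
move=> gap; apply: hk_step_ge => a; rewrite mem_neighborhood ler_norml.
by case: (gap a) => // ? /andP[? ?]; lra.
Qed.

(** No neighbour lies below [z (inl i)] and the strategic one exceeds it by exactly 1; this surplus
    is shared among at most [n + m] neighbours. *)
Lemma hk_step_pulled (R : realType) n m (z : agent n m -> R) i s :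
  (forall a, z (inl i) <= z a \/ z a + 1 < z (inl i)) ->
  z (inr s) = z (inl i) + 1 ->
  z (inl i) + (n + m)%:R^-1 <= hk_step z i.
Proof.
move=> gap zs; set u := z (inl i) in gap zs *.
have nbr_ge a : a \in neighborhood z i -> u <= z a.
  rewrite mem_neighborhood ler_norml -/u.
  by case: (gap a) => // ? /andP[? ?]; lra.
have card_gt0 := card_neighborhood_gt0 z i.
have s_nbr : inr s \in neighborhood z i.
  by rewrite mem_neighborhood zs ler_norml; apply/andP; split; rewrite -/u; lra.
apply: (@le_trans _ _ (u + #|neighborhood z i|%:R^-1)).
  rewrite lerD2l lef_pV2 ?posrE// ?ler_nat.
    by apply: leq_trans (max_card _) _; rewrite card_sum !card_ord.
  rewrite ltr0n; have := ltn_ord i; lia.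
rewrite /hk_step ler_pdivlMr// mulrDl mulVf ?gt_eqF// mulr_natr -sumr_const.
rewrite -lerBrDl -sumrB (bigD1 (inr s))//= zs (addrC u) addrK lerDl.
by apply: sumr_ge0 => a /andP[/nbr_ge ua _]; rewrite subr_ge0.
Qed.

(** Transitivity makes closeness an equivalence relation. Agents of one class have equal
    neighbourhoods, hence equal averages; the averages of two classes inherit the separation of
    their members. *)
Lemma hk_step_cluster (R : realType) n m (x : 'I_n -> R) (y : 'I_m -> R) :
  (forall i s, 1 < `|x i - y s|) ->
  (forall i j k, `|x i - x j| <= 1 -> `|x j - x k| <= 1 -> `|x i - x k| <= 1) ->
  forall i j, let x' := hk_step (profile x y) in
    x' i = x' j \/ 1 < `|x' i - x' j|.
Proof.
move=> far trans i j x'.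
set z := profile x y.
have no_inr k s : inr s \in neighborhood z k = false.
  by rewrite mem_neighborhood leNgt far.
have sep i0 j0 : x i0 + 1 < x j0 -> 1 < `|x' i0 - x' j0|.
  move=> ij; rewrite distrC.
  have [b b_nbr b_min] := @arg_minP _ _ _ (inl j0)
    [in neighborhood z j0] z (neighborhood_refl z j0).
  have zb : z b <= x' j0 by apply: hk_step_ge => a; exact: b_min.
  suff : x' i0 < z b - 1.
    by move=> ?; rewrite ltr_normr; apply/orP; left; lra.
  apply: hk_step_lt => a a_nbr.
  case: b b_nbr {b_min zb} => [b|s]; last by rewrite no_inr.
  case: a a_nbr => [a|s]; last by rewrite no_inr.
  rewrite !mem_neighborhood /= => ia jb.
  (* If [a] and [b] were close, the chain from [i0] through [a] and [b] to [j0] would make [i0] and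
     [j0] close. If not, [a] lies more than 1 below [b], since both are within reach of [i0] and
     [j0] respectively. *)
  have [ab|ab] := lerP `|x a - x b| 1.
    have := trans _ _ _ ia ab; rewrite distrC in jb.
    move=> /trans /(_ jb).
    by rewrite ler_norml => /andP[? ?]; lra.
  move: ia jb ab; rewrite !ler_norml ltr_normr => /andP[? ?] /andP[? ?] /orP[] ?;
    lra.
have [ij|] := lerP `|x i - x j| 1; last first.
  rewrite ltr_normr => /orP[] ?; right.
    by rewrite distrC; apply: sep; lra.
  by apply: sep; lra.
left; rewrite /x' /hk_step; suff -> : neighborhood z i = neighborhood z j by [].
apply/setP => -[k|s]; last by rewrite !no_inr.
rewrite !mem_neighborhood /=; apply/idP/idP; apply: trans => //.
by rewrite distrC.
Qed.

(** * Potential and clusters of a sorted sequence *)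

(* The potential of the sorted opinions [X] is [X k - wide_gaps X k], with [k]
   the last index. *)
Fixpoint wide_gaps (R : realType) (X : nat -> R) (k : nat) : R :=
  if k is j.+1 then
    wide_gaps X j + (if 1 < X k - X j then X k - X j else 0)
  else X 0%N.

Fixpoint cluster_start (R : realType) (X : nat -> R) (k : nat) : nat :=
  if k is j.+1 then if 1 < X k - X j then k else cluster_start X j else 0.

Definition nondecreasing_below (R : realType) (n : nat) (X : nat -> R) :=
  forall j k, (j <= k < n)%N -> X j <= X k.

Lemma wide_gaps_le (R : realType) n (X : nat -> R) k :
  nondecreasing_below n X -> (k < n)%N -> wide_gaps X k <= X k.
Proof.
move=> ndX; elim: k => [//|k IH] kn /=.
have := IH (ltnW kn); have := ndX k k.+1; rewrite leqnSn kn => /(_ isT).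
by case: ifP => _; lra.
Qed.

Lemma wide_gaps_ge (R : realType) (X : nat -> R) k :
  X k - k%:R <= wide_gaps X k.
Proof.
elim: k => [|k IH] /=; first by rewrite subr0.
by rewrite -natr1; case: ltrP; lra.
Qed.

(** Wide gaps of [X] stay wide in [Y], since their ends only move apart, and newly wide gaps only
    add. The gain [d] enters once, at index [k0]: through the wide gap ending there, or through the
    initial term if [k0 = 0]. *)
Lemma wide_gaps_progress (R : realType) n (X Y : nat -> R) (k0 : nat) d k :
  nondecreasing_below n X -> nondecreasing_below n Y ->
  (forall j, (j.+1 < n)%N -> 1 < X j.+1 - X j ->
     Y j <= X j /\ X j.+1 + (k0 == j.+1)%:R * d <= Y j.+1) ->
  X 0 + (k0 == 0)%:R * d <= Y 0 ->
  (forall j, k0 = j.+1 -> 1 < X j.+1 - X j) ->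
  0 <= d ->
  (k < n)%N -> wide_gaps X k + (k0 <= k)%:R * d <= wide_gaps Y k.
Proof.
move=> ndX ndY gapXY XY0 start d0; elim: k => [|k IH] kn /=; first by rewrite leqn0.
have {IH} := IH (ltnW kn).
have := ndY k k.+1; rewrite leqnSn kn => /(_ isT) Yk.
rewrite (leq_eqVlt k0 k.+1) ltnS.
have [wX|nX] := boolP (1 < X k.+1 - X k).
  have [? ] := gapXY k kn wX.
  case: eqP => [->|_] /=; rewrite ?ltnn /= ?(mulr1n, mulr0n) ?mul1r ?mul0r;
    by move=> ? ?; rewrite ifT; lra.
case: eqP => [k0k|_ /=]; first by rewrite start in nX.
by case: ifP => _ ?; lra.
Qed.

Lemma cluster_start_le (R : realType) (X : nat -> R) k :
  (cluster_start X k <= k)%N.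
Proof. by elim: k => //= k IH; case: ifP => // _; exact: leqW. Qed.

Lemma cluster_start_gap (R : realType) (X : nat -> R) k j :
  cluster_start X k = j.+1 -> 1 < X j.+1 - X j.
Proof. by elim: k => //= k IH; case: ifP => // + [<-]. Qed.

Lemma cluster_start_eq (R : realType) n (X : nat -> R) j k :
  nondecreasing_below n X -> (j <= k < n)%N -> X k - X j <= 1 ->
  cluster_start X j = cluster_start X k.
Proof.
move=> ndX; elim: k => [|k IH]; first by case: j.
rewrite leq_eqVlt ltnS => /andP[/orP[/eqP-> //|jk] kn] Xkj /=.
have Xjk : X j <= X k by apply: ndX; rewrite jk ltnW.
have Xk : X k <= X k.+1 by apply: ndX; rewrite leqnSn.
rewrite ifF; last by lra.
by apply: IH; [rewrite jk ltnW|lra].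
Qed.

Lemma cluster_start_dichotomy (R : realType) n (X : nat -> R) :
  (forall k, (k < n)%N -> X k <= X (cluster_start X k) + 1) \/
  exists k0 k, [/\ (k0 <= k)%N, (k.+1 < n)%N,
    X k <= X k0 + 1 < X k.+1, X k.+1 <= X k + 1 &
    forall j, k0 = j.+1 -> 1 < X j.+1 - X j].
Proof.
have [small|] := pselect (forall k, (k < n)%N -> X k <= X (cluster_start X k) + 1).
  by left.
move=> /existsNP[k1 /not_implyP[k1n /negP]]; rewrite -ltNge => k1P; right.
have exP : exists k, (k < n)%N && (X (cluster_start X k) + 1 < X k).
  by exists k1; rewrite k1n.
(* At the first index [k.+1] that is too far from its cluster start, minimality puts [k] within
   reach, so start plus 1 falls between the two; the gap there is not wide because both share the
   start. *)
case: (ex_minnP exP) => -[|k] /andP[kn Pk] kmin; first by move: Pk => /=; lra.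
move: Pk => /=; case: ifP => [_|wk Pk]; first by lra.
exists (cluster_start X k), k; split => //.
- exact: cluster_start_le.
- rewrite Pk andbT leNgt; apply/negP => Pk'.
  by have := kmin k; rewrite (ltnW kn) Pk' ltnn => /(_ isT).
- by move/negbT: wk; rewrite -leNgt; lra.
- by move=> j; exact: cluster_start_gap.
Qed.

(** * Steering sorted profiles; one enumeration [s] serves for all times *)

Definition sorts (R : realType) n (x : 'I_n -> R) (s : nat -> 'I_n) :=
  nondecreasing_below n (x \o s) /\ forall i, exists2 k, (k < n)%N & s k = i.

Lemma exists_sorts (R : realType) n (x : 'I_n -> R) :
  (0 < n)%N -> exists s, sorts x s.
Proof.
move=> n_gt0; pose i0 := Ordinal n_gt0.
pose le_x := relpre x <=%R; pose r := sort le_x (enum 'I_n).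
have size_r : size r = n by rewrite size_sort size_enum_ord.
have r_sorted : sorted le_x r by apply: sort_sorted => i j; exact: le_total.
exists (nth i0 r); split => [j k /andP[jk kn]|i].
  apply: (sorted_leq_nth _ _ i0 r_sorted) => //; rewrite ?inE ?size_r//.
  - by move=> a b c; exact: le_trans.
  - by move=> a; exact: lexx.
  - exact: leq_ltn_trans kn.
have ir : i \in r by rewrite mem_sort mem_enum.
exists (index i r); last exact: nth_index.
by move: ir; rewrite -index_mem size_r.
Qed.

Lemma hk_step_progress (R : realType) n (x : 'I_n -> R) s k0 k :
  sorts x s -> (k0 <= k)%N -> (k.+1 < n)%N ->
  x (s k) <= x (s k0) + 1 < x (s k.+1) -> x (s k.+1) <= x (s k) + 1 ->
  (forall j, k0 = j.+1 -> 1 < x (s j.+1) - x (s j)) ->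
  let x' := hk_step (profile x (fun _ : 'I_1 => x (s k0) + 1)) in
  [/\ sorts x' s, x' (s n.-1) <= x (s n.-1) &
      wide_gaps (x \o s) n.-1 + n.+1%:R^-1 <= wide_gaps (x' \o s) n.-1].
Proof.
move=> [ndx surj] k0k kn /andP[ck ck1] wk start x'.
set c := x (s k0) + 1 in ck ck1 x' *.
set z := profile x (fun _ : 'I_1 => c) in x' *.
(* No agent, strategic or not, lies strictly inside a wide gap, so its two ends do not see across
   it. *)
have split_gap j : (j.+1 < n)%N -> 1 < x (s j.+1) - x (s j) ->
    forall a, z a <= x (s j) \/ x (s j.+1) <= z a.
  move=> jn wj [i|o] /=.
    have [l ln <-] := surj i; have [lj|jl] := leqP l j.
      by left; apply: ndx; rewrite lj ltnW.
    by right; apply: ndx; rewrite jl.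
  case: (ltngtP k j) => [kj|jk|kj].
  - left; apply: (le_trans (ltW ck1)); apply: ndx; rewrite kj; lia.
  - right; apply: le_trans ck; apply: ndx; rewrite jk; lia.
  - by move: wj; rewrite -kj; lra.
have min0 a : x (s 0%N) <= z a.
  case: a => [i|o] /=; first by have [l ln <-] := surj i; apply: ndx.
  have : x (s 0%N) <= x (s k0) by apply: ndx => /=; lia.
  by rewrite /c; lra.
have ndx' : nondecreasing_below n (x' \o s).
  by move=> j l jl; apply: hk_step_homo; exact: ndx.
split; first by split.
  apply: hk_step_le_gap => -[i|o]; left => /=.
    by have [l ln <-] := surj i; apply: ndx; lia.
  by apply: (le_trans (ltW ck1)); apply: ndx; lia.
have -> : n.+1%:R^-1 = (k0 <= n.-1)%:R * n.+1%:R^-1 :> R.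
  by rewrite (_ : (k0 <= n.-1)%N) ?mul1r//; lia.
have pulled : (forall a, x (s k0) <= z a \/ z a + 1 < x (s k0)) ->
    x (s k0) + n.+1%:R^-1 <= x' (s k0).
  by move=> ?; rewrite -(addn1 n); exact: (@hk_step_pulled _ _ _ z (s k0) ord0).
apply: (@wide_gaps_progress _ n) => //=; last by lia.
- move=> j jn wj; have split_j := split_gap j jn wj; split.
    by apply: hk_step_le_gap => a; case: (split_j a) => /= ?; [left|right; lra].
  have ge_gap a : x (s j.+1) <= z a \/ z a + 1 < x (s j.+1).
    by case: (split_j a) => ?; [right; lra|left].
  case: eqP => [k0j|_] /=; last by rewrite mul0r addr0; exact: hk_step_ge_gap.
  by rewrite mul1r -k0j; apply: pulled => a; rewrite k0j.
- case: eqP => [k00|_] /=.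
    by rewrite mul1r -k00; apply: pulled => a; left; rewrite k00.
  by rewrite mul0r addr0; apply: hk_step_ge_gap => a; left.
Qed.

(** When clusters have length at most 1, closeness means having the same [cluster_start], and
    equality is transitive. *)
Lemma close_trans_of_small_clusters (R : realType) n (x : 'I_n -> R) s :
  sorts x s ->
  (forall k, (k < n)%N -> x (s k) <= x (s (cluster_start (x \o s) k)) + 1) ->
  forall i j k,
    `|x i - x j| <= 1 -> `|x j - x k| <= 1 -> `|x i - x k| <= 1.
Proof.
move=> [ndx surj] small i j k.
have [a an <-] := surj i; have [b bn <-] := surj j; have [c cn <-] := surj k.
have closeE u v : (u < n)%N -> (v < n)%N ->
    (`|x (s u) - x (s v)| <= 1) =
    (cluster_start (x \o s) u == cluster_start (x \o s) v).
  wlog uv : u v / (u <= v)%N => [wlog un vn|un vn].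
    have [|/ltnW] := leqP u v => uv; first exact: wlog.
    by rewrite distrC eq_sym; exact: wlog.
  have xuv : x (s u) <= x (s v) by apply: ndx; rewrite uv.
  rewrite distrC ger0_norm ?subr_ge0//.
  apply/idP/eqP => [|uvE].
    by apply: cluster_start_eq; [exact: ndx|rewrite uv].
  have := small v vn; rewrite -uvE.
  have : x (s (cluster_start (x \o s) u)) <= x (s u).
    by apply: ndx; rewrite cluster_start_le.
  by lra.
by rewrite !closeE// => /eqP-> .
Qed.

(** Lets an induction prepend one strategic move to a control for the next profile. *)
Lemma opinion_shift (R : realType) n m (x : 'I_n -> R) (y0 : 'I_m -> R) y t :
  opinion x (fun u => if u is v.+1 then y v else y0) t.+1 =
  opinion (hk_step (profile x y0)) y t.
Proof. by elim: t => //= t <-. Qed.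

Lemma exists_converged_at1 (R : realType) n (x : 'I_n -> R) s :
  (0 < n)%N -> sorts x s ->
  (forall k, (k < n)%N -> x (s k) <= x (s (cluster_start (x \o s) k)) + 1) ->
  exists y : nat -> 'I_1 -> R, converged_at x y 1.
Proof.
(* Two above the highest opinion is out of everyone's sight. *)
move=> n_gt0 xs small; exists (fun _ _ => x (s n.-1) + 2).
apply: (hk_step_cluster _ (close_trans_of_small_clusters xs small)) => i _.
have [ndx surj] := xs; have [k kn <-] := surj i.
have : x (s k) <= x (s n.-1) by apply: ndx; lia.
by move=> ?; rewrite ltr_normr; apply/orP; right; lra.
Qed.

(** [K] bounds the number of pulls still affordable; the extra step in [K.+1] is the final
    collapse. *)
Lemma exists_convergent_control (R : realType) n (x : 'I_n -> R) s K :
  (0 < n)%N -> sorts x s ->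
  x (s n.-1) - wide_gaps (x \o s) n.-1 <= K%:R / n.+1%:R ->
  exists (y : nat -> 'I_1 -> R) t, (t <= K.+1)%N /\ converged_at x y t.
Proof.
move=> n_gt0; elim: K x => [|K IH] x xs xK;
  have [small|[k0 [k [k0k kn ck wk start]]]] := cluster_start_dichotomy n (x \o s);
  try by have [y yt] := exists_converged_at1 n_gt0 xs small; exists y, 1%N.
(* With [K = 0] a pull would make the potential negative, against [wide_gaps_le]. *)
- have [[ndx' _] x'x progress] := hk_step_progress xs k0k kn ck wk start.
  have n1 : (n.-1 < n)%N by lia.
  have /= := wide_gaps_le ndx' n1; have : 0 < n.+1%:R^-1 :> R by rewrite invr_gt0.
  by move: xK progress; rewrite mul0r; move: (n.+1%:R^-1) => d; lra.
- have [x's x'x progress] := hk_step_progress xs k0k kn ck wk start.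
  have [|y [t [tK yt]]] := IH _ x's.
    move: xK progress; rewrite -natr1 mulrDl mul1r.
    by move: (n.+1%:R^-1) => d; lra.
  exists (fun u => if u is v.+1 then y v else fun=> x (s k0) + 1), t.+1.
  by split => //; rewrite /converged_at opinion_shift.
Qed.

Theorem corollary9 (R : realType) :
  exists2 C : R, 0 < C &
    exists n0 : nat, forall n : nat, (n0 <= n)%N ->
      (worst_case_time R n 1 <= (C * n%:R ^+ 2)%:E)%E.
Proof.
exists 1 => //; exists 1%N => n n_gt0.
apply: ge_ereal_sup => _ [x0 _ <-].
have [s xs] := exists_sorts x0 n_gt0.
(* The potential is at most [n - 1] and each pull costs [1 / (n + 1)]. With the collapse this gives
   [(n - 1) * (n + 1) + 1 = n ^ 2] steps, hence the constant 1. *)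
have [|y [t [tn yt]]] := @exists_convergent_control R n x0 s (n.-1 * n.+1) n_gt0 xs.
  rewrite natrM mulfK ?pnatr_eq0//.
  by have := wide_gaps_ge (x0 \o s) n.-1 => /=; lra.
apply: (@le_trans _ _ (convergence_time x0 y)).
  by apply: ereal_inf_lbound; exists y.
apply: (@le_trans _ _ (t%:R)%:E).
  by apply: ereal_inf_lbound; exists t.
rewrite lee_fin mul1r -natrX ler_nat.
by apply: (leq_trans tn); nia.
Qed.
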